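(* Let $k,\ell\in\mathbb{N}$ with $\ell\le k$, $p\in[1,\infty)$, let $q\in(0,\infty)$ satisfy $n(\frac1p-\frac1q)\ge\ell$, and let $\gamma=-\ell q$. Then there exists $f\in C_{\rm c}^\infty(\mathbb{R}^n)$ such that $$\sup_{\lambda\in(0,\infty)}\lambda^p\int_{\mathbb{R}^n}\left[\int_{\mathbb{R}^n}\mathbf 1_{E_{\lambda,\frac\gamma q,k,\ell}[f]}(x,h)|h|^{\gamma-n}\,dh\right]^{\frac pq}dx=\infty.$$
   Context: $\Delta_h^kf(x):=\sum_{j=0}^k(-1)^{k-j}\binom kjf(x+jh)$. For $\lambda\in(0,\infty)$, $b\in\mathbb{R}$: $E_{\lambda,b,k,\ell}[f]:=\{(x,h)\in\mathbb{R}^n\times(\mathbb{R}^n\setminus\{\mathbf 0\}):|\Delta_h^kf(x)|>\lambda|h|^{b+\ell}\}$. $C_{\rm c}^\infty(\mathbb{R}^n)$ is the set of infinitely differentiable functions on $\mathbb{R}^n$ with compact support. *)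

(* Defs.v *)
From HB Require Import structures.
From mathcomp Require Import all_boot all_order all_algebra.
From mathcomp Require Import all_classical all_reals all_analysis.

Set Implicit Arguments.
Unset Strict Implicit.
Unset Printing Implicit Defensive.

Import Order.TTheory GRing.Theory Num.Theory.
Import numFieldNormedType.Exports.

Local Open Scope classical_set_scope.
Local Open Scope ring_scope.

Section measurable_rV.
Variables (R : realType) (n : nat).

Definition rV_coord (i : 'I_n) (x : 'rV[R]_n) : R := x ord0 i.

Let rV_set0 : g_sigma_preimage rV_coord set0.
Proof. exact: sigma_algebra0. Qed.

Let rV_setC A : g_sigma_preimage rV_coord A -> g_sigma_preimage rV_coord (~` A).
Proof. exact: sigma_algebraC. Qed.

Let rV_bigcup (F : (set 'rV[R]_n)^nat) :
  (forall i, g_sigma_preimage rV_coord (F i)) ->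
  g_sigma_preimage rV_coord (\bigcup_i (F i)).
Proof. exact: sigma_algebra_bigcup. Qed.

(* The Borel sigma-algebra of R^n, presented (as the library does for tuples)
   as the one generated by the coordinate maps. *)
HB.instance Definition _ :=
  @isMeasurable.Build (measure_tuple_display default_measure_display)
    'rV[R]_n (g_sigma_preimage rV_coord) rV_set0 rV_setC rV_bigcup.

End measurable_rV.

Section lebesgue_rV.
Variable R : realType.

Lemma measurable_rV_coord n (i : 'I_n) :
  measurable_fun [set: 'rV[R]_n] (rV_coord i).
Proof.
move=> _ Y mY; rewrite setTI; apply: sub_sigma_algebra => /=.
rewrite -bigcup_seq/=; exists i => /=; first by rewrite mem_index_enum.
by exists Y => //; rewrite setTI.
Qed.

Lemma measurable_fun_rVP d (T : measurableType d) n (f : T -> 'rV[R]_n) :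
  (forall i, measurable_fun [set: T] (rV_coord i \o f)) ->
  measurable_fun [set: T] f.
Proof.
move=> mf _ A mA; rewrite setTI.
suff : g_sigma_preimage (fun i => rV_coord i \o f) (f @^-1` A).
  apply: smallest_sub; first exact: sigma_algebra_measurable.
  rewrite -bigcup_seq => B [i _] [C mC <-]; exact: mf.
by rewrite g_sigma_preimage_comp; exists A => //; rewrite setTI.
Qed.

Definition rV_cons n (p : 'rV[R]_n * R) : 'rV[R]_n.+1 :=
  row_mx (p.2)%:M p.1 : 'rV[R]_(1 + n).

Lemma rV_coord_cons0 n p : rV_coord ord0 (@rV_cons n p) = p.2.
Proof.
rewrite /rV_coord /rV_cons.
have -> : ord0 = lshift n ord0 :> 'I_(1 + n) by apply: val_inj.
by rewrite (@row_mxEl R 1 1 n) mxE.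
Qed.

Lemma rV_coord_consS n p (j : 'I_n) :
  rV_coord (lift ord0 j) (rV_cons p) = rV_coord j p.1.
Proof.
rewrite /rV_coord /rV_cons.
have -> : lift ord0 j = rshift 1 j :> 'I_(1 + n) by apply: val_inj.
by rewrite (@row_mxEr R 1 1 n).
Qed.

Lemma measurable_rV_cons n : measurable_fun [set: 'rV[R]_n * R] (@rV_cons n).
Proof.
apply: measurable_fun_rVP => i; case: (unliftP ord0 i) => [j ->|->].
- rewrite (_ : _ \o _ = rV_coord j \o fst); last first.
    by apply/funext => p /=; rewrite rV_coord_consS.
  by apply: measurableT_comp; first exact: measurable_rV_coord.
- rewrite (_ : _ \o _ = snd); first exact: measurable_snd.
  by apply/funext => p /=; rewrite rV_coord_cons0.
Qed.

Section lebesgue_rV_succ.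
Context n (mu : {measure set 'rV[R]_n -> \bar R}).

Definition lebesgue_rV_succ : set 'rV[R]_n.+1 -> \bar R :=
  pushforward (mu \x @lebesgue_measure R)%E (@rV_cons n).

Let nu : {measure set 'rV[R]_n.+1 -> \bar R} :=
  measure_function_pushforward__canonical__measure_function_Measure
    (mu \x @lebesgue_measure R)%E (@measurable_rV_cons n).

HB.instance Definition _ := isMeasure.Build _ _ _ lebesgue_rV_succ
  (measure0 nu) (measure_ge0 nu) (@measure_semi_sigma_additive _ _ _ nu).

End lebesgue_rV_succ.

(* n-dimensional Lebesgue measure (on Borel sets), as an iterated product of
   the one-dimensional one; lebesgue_rV_box characterizes it. *)
Fixpoint lebesgue_rV n : {measure set 'rV[R]_n -> \bar R} :=
  match n with
  | 0 => dirac (0 : 'rV[R]_0)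
  | m.+1 => lebesgue_rV_succ (lebesgue_rV m)
  end.

Lemma measurable_rV_box n (A : 'I_n -> set R) :
  (forall i, measurable (A i)) ->
  measurable [set x : 'rV[R]_n | forall i, A i (x ord0 i)].
Proof.
move=> mA.
rewrite (_ : mkset _ = \big[setI/setT]_(i < n) (rV_coord i @^-1` A i)).
  apply: bigsetI_measurable => i _; rewrite -[X in measurable X]setTI.
  exact: measurable_rV_coord.
apply/seteqP; split => x; rewrite -bigcap_seq /=.
  by move=> xA i _; exact: xA.
by move=> xA i; apply: xA; rewrite /= mem_index_enum.
Qed.

Lemma lebesgue_rV_box n (A : 'I_n -> set R) :
  (forall i, measurable (A i)) ->
  lebesgue_rV n [set x | forall i, A i (x ord0 i)] =
  (\prod_(i < n) lebesgue_measure (A i))%E.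
Proof.
elim: n A => [|n IHn] A mA.
  rewrite big_ord0 /= diracE mem_set//=.
  by case.
rewrite big_ord_recl /= /lebesgue_rV_succ /pushforward.
rewrite (_ : _ @^-1` _ =
    [set x : 'rV[R]_n | forall i, A (lift ord0 i) (x ord0 i)] `*` A ord0).
  rewrite product_measure1E; first by rewrite muleC -IHn.
  - by apply: (@measurable_rV_box _ (fun i => A (lift ord0 i))) => i; exact: mA.
  - exact: mA.
apply/seteqP; split => [p /= Ap|p /= [Ap1 Ap2] i].
  split=> [i|].
    by rewrite -[p.1 ord0 i]/(rV_coord i p.1) -rV_coord_consS; exact: Ap.
  by rewrite -rV_coord_cons0; exact: Ap.
case: (unliftP ord0 i) => [j ->|->].
  by have := Ap1 j; rewrite -[p.1 ord0 j]/(rV_coord j p.1) -rV_coord_consS.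
by move: Ap2; rewrite -rV_coord_cons0.
Qed.

End lebesgue_rV.

Section Cc_infty.
Variables (R : realType) (n : nat).
Implicit Types f : 'rV[R]_n -> R.

(* iter_partial s f = d_{s_1} d_{s_2} ... d_{s_m} f *)
Definition iter_partial (s : seq 'I_n) f : 'rV[R]_n -> R :=
  foldr (fun i g x => 'D_('e_i) g x) f s.

Definition smooth f := forall s : seq 'I_n,
  continuous (iter_partial s f) /\
  forall x i, derivable (iter_partial s f) x 'e_i.

Definition compactly_supported f := compact (closure [set x | f x != 0]).

Definition Cc_infty : set ('rV[R]_n -> R) :=
  [set f | smooth f /\ compactly_supported f].

End Cc_infty.

Section differences.
Variables (R : realType) (n : nat).
Implicit Types (f : 'rV[R]_n -> R) (x h : 'rV[R]_n).

(* The library's norm `|x| on row vectors is the sup norm. *)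
Definition enorm x : R := Num.sqrt (\sum_(i < n) x ord0 i ^+ 2).

Definition fdiff (k : nat) h f x : R :=
  \sum_(j < k.+1) (-1) ^+ (k - j) * 'C(k, j)%:R * f (x + j%:R *: h).

Definition Eset (lambda b : R) (k l : nat) f : set ('rV[R]_n * 'rV[R]_n) :=
  [set xh | xh.2 != 0 /\
    lambda * enorm xh.2 `^ (b + l%:R) < `|fdiff k xh.2 f xh.1|].

End differences.

(* Main.v *)
Require Import Defs.
From mathcomp Require Import all_boot all_order all_algebra.
From mathcomp Require Import all_classical all_reals all_analysis.
From mathcomp Require Import measurable_realfun ring lra.

Set Implicit Arguments.
Unset Strict Implicit.
Unset Printing Implicit Defensive.

Import Order.TTheory GRing.Theory Num.Theory.
Import numFieldNormedType.Exports.

Local Open Scope classical_set_scope.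
Local Open Scope ring_scope.

(** Since gamma = - l q, the exponent gamma / q + l of |h| in the definition of
    the level set vanishes, so E_lambda is just the set where h <> 0 and
    |Delta_h^k f(x)| > lambda.  No supremum is needed: for a bump function f
    supported in the unit cube and one small lambda, the double integral is
    already infinite, for k >= 1 because of the large x, and for k = 0 because
    of the large h.

    Let k >= 1 and let x be far from the origin, of size rho.  If x + k h is
    near 0, the intermediate points x + j h with j < k are still outside the
    support of f, so that Delta_h^k f(x) = f(x + k h) > lambda.  These h fill a
    cube of side 1 / k and have size at most a constant times rho, so that the
    inner integral is at least a constant times rho^(gamma - n)
    ([inner_integral_far]).  Its power p / q is at least a constant times
    rho^((gamma - n) p / q), and the hypothesis l <= n (1/p - 1/q) says exactly
    that (gamma - n) p / q >= - n.  A function that is at least c rho^(-n) at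
    distance rho is not integrable at infinity: each of the dyadic cubes
    [rho, 2 rho)^n contributes at least c ([integral_dyadic_pinfty]).

    If k = 0 then l = 0, and Delta_h^0 f(x) = f(x) does not depend on h.  For x
    near 0 the inner integral is that of |h|^(-n), infinite by the same
    dyadic argument ([inner_integral_order0]).

    The bump function is the product over the coordinates of
    exp(-1 / (1 - t^2)), cut off outside (-1, 1).  Its derivatives all have the
    form p(t) w^m exp(-w) with p a polynomial and w = 1 / (1 - t^2); this family
    is closed under differentiation ([is_derive_bump]), and partial derivatives
    of a product of one-variable functions only act on one factor
    ([is_derive_tensor]). *)

(** * A smooth compactly supported function *)

(** Used at the boundary points and outside of the interval, where the
    differentiation rules do not apply. *)
Lemma is_derive_quadratic (R : realType) (f : R -> R) (t C : R) :
  (forall s, `|f s - f t| <= C * (s - t) ^+ 2) -> is_derive t 1 f 0.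
Proof.
move=> fC.
have C0 : 0 <= C.
  by have := fC (t + 1); rewrite addrAC subrr add0r expr1n mulr1;
    exact: le_trans.
have cv : (fun h => h^-1 *: ((f \o shift t) (h *: 1) - f t)) @ 0^' --> (0 : R).
  apply/cvgr0Pnorm_le => e e0.
  near=> h.
  have h0 : h != 0 by near: h; exact: nbhs_dnbhs_neq.
  rewrite normrZ normfV ler_pdivrMl ?normr_gt0//= (le_trans (fC _))//.
  rewrite scaler1 addrK -real_normK ?num_real// expr2 mulrCA.
  rewrite ler_pM2l ?normr_gt0//.
  have he : `|h| <= e / (C + 1).
    near: h; apply: dnbhs0_le; rewrite divr_gt0// ltr_wpDl//.
  apply: le_trans (ler_wpM2l C0 he) _.
  by rewrite mulrCA ler_piMr ?(ltW e0)// ler_pdivrMr ?mul1r ?lerDl// ltr_wpDl.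
split; first by apply/cvg_ex; exists 0.
exact/cvg_lim.
Unshelve. all: by end_near. Qed.

(** The general derivative of exp(-1 / (1 - t^2)): the polynomial [p] and the
    power of 1 / (1 - t^2) are kept apart because both change when one
    differentiates. *)
Definition bump (R : realType) (p : {poly R}) (m : nat) (t : R) : R :=
  if `|t| < 1 then p.[t] * (1 - t ^+ 2)^-1 ^+ m * expR (- (1 - t ^+ 2)^-1)
  else 0.

Lemma bump_out (R : realType) (p : {poly R}) m t : 1 <= `|t| -> bump p m t = 0.
Proof. by rewrite /bump ltNge => ->. Qed.

(** With w = 1 / (1 - t^2), the claim is that w^(m+2) exp(-w) is bounded, which
    follows from w^(m+2) / (m+2)! <= exp w; on the interval p is bounded by the
    sum of the absolute values of its coefficients.  The second power of
    1 - t^2 is what makes the derivative vanish at the end points. *)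
Lemma bump_bound (R : realType) (p : {poly R}) m :
  exists2 C : R, 0 <= C &
    forall t, `|t| < 1 -> `|bump p m t| <= C * (1 - t ^+ 2) ^+ 2.
Proof.
pose S : R := \sum_(i < size p) `|p`_i|.
have S0 : 0 <= S by apply: sumr_ge0.
exists (S * (m.+2)`!%:R); first by rewrite mulr_ge0.
move=> t t1; rewrite /bump t1.
set u := 1 - t ^+ 2; set w := u^-1.
have u0 : 0 < u by rewrite subr_gt0 -real_normK ?num_real// expr_lt1.
have w0 : 0 < w by rewrite invr_gt0.
rewrite !normrM -mulrA [`|w ^+ m|]ger0_norm ?exprn_ge0 ?(ltW w0)//.
rewrite [`|expR _|]ger0_norm ?expR_ge0//.
rewrite -mulrA ler_pM//; first by rewrite mulr_ge0 ?expR_ge0// exprn_ge0// ltW.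
  rewrite horner_coef (le_trans (ler_norm_sum _ _ _))// ler_sum// => i _.
  by rewrite normrM normrX ler_piMr// exprn_ile1// ltW.
have uE : u = w^-1 by rewrite invrK.
clearbody w u.
rewrite uE exprVn ler_pdivlMr ?exprn_gt0// mulrAC -exprD addn2 expRN.
rewrite ler_pdivrMr ?expR_gt0// -ler_pdivrMl ?ltr0n ?fact_gt0// mulrC.
apply: le_trans (expR_ge1Dxn m.+1 (ltW w0)).
by rewrite lerDr.
Qed.

(** Since w' = 2 t w^2, the derivative of p w^m exp(-w) is
    (p' + 2 m t p w - 2 t p w^2) w^m exp(-w); factoring out w^(m+2) leaves this
    polynomial. *)
Definition bump_deriv (R : realType) (p : {poly R}) (m : nat) : {poly R} :=
  p^`() * (1 - 'X^2) ^+ 2 + 2%:R *: ('X * p * (m%:R *: (1 - 'X^2) - 1)).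

Lemma is_derive_bump (R : realType) (p : {poly R}) m (t : R) :
  is_derive t 1 (bump p m) (bump (bump_deriv p m) m.+2 t).
Proof.
have [t1|t1] := ltP `|t| 1; last first.
  rewrite (bump_out (bump_deriv p m) _ t1).
  have [C C0 HC] := bump_bound p m.
  apply: (@is_derive_quadratic _ _ _ (C * 4)) => s.
  rewrite (bump_out _ _ t1) subr0.
  have [s1|s1] := ltP `|s| 1; last first.
    by rewrite bump_out// normr0 mulr_ge0 ?sqr_ge0 ?mulr_ge0.
  (* 1 - s^2 <= 2 (1 - |s|) <= 2 (|t| - |s|) <= 2 |s - t| *)
  rewrite (le_trans (HC _ s1))// -mulrA ler_wpM2l//.
  have -> : 4 * (s - t) ^+ 2 = (2 * `|s - t|) ^+ 2 :> R.
    by rewrite exprMn real_normK ?num_real// -natrX.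
  have Hs := normr_ge0 s.
  have ss : s ^+ 2 = `|s| ^+ 2 by rewrite real_normK ?num_real.
  have st : `|t| - `|s| <= `|s - t| by rewrite distrC lerB_dist.
  rewrite ler_sqr ?nnegrE; [nra|nra|by rewrite mulr_ge0].
apply: (@near_eq_is_derive _ _ _
  (fun s => p.[s] * (1 - s ^+ 2)^-1 ^+ m * expR (- (1 - s ^+ 2)^-1))).
  near=> s; rewrite /bump ifT//.
  near: s.
  apply: (@cvgr_norm_lt _ _ _ (nbhs t) _ id t) => //.
have u0 : 1 - t ^+ 2 != 0.
  by rewrite gt_eqF// subr_gt0 -real_normK ?num_real// expr_lt1.
rewrite /bump t1.
pose g s : R := 1 - s ^+ 2.
have du : is_derive t 1 g (- (t *+ 2)).
  apply: is_derive_eq; rewrite /GRing.scale/=; ring.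
have dw : is_derive t 1 (fun s => (g s)^-1) ((g t)^-1 ^+ 2 * (t *+ 2)).
  have H := @is_deriveV R g t _ 1 u0 du.
  apply: is_derive_eq H _.
  by rewrite exprVn /GRing.scale/= mulNr mulrN opprK.
have dwm := @is_deriveX _ _ _ m _ _ _ dw.
have de := @is_derive1_comp R expR (- (fun s => (g s)^-1)) t _ _
  (is_derive_expR (- (g t)^-1)) (is_deriveN dw).
have dp := is_derive_poly p t.
have dall := is_deriveM (is_deriveM dp dwm) de.
rewrite (_ : (fun s => _) = horner p * (fun s => (g s)^-1) ^+ m *
  (expR \o (- (fun s => (g s)^-1)))); last first.
  by apply/funext => s /=; rewrite !fctE.
apply: is_derive_eq dall _.
(* multiplying by g t * (g t)^-1 = 1 removes the truncated exponent m.-1 *)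
have mw : m%:R * (g t)^-1 ^+ m.-1 = m%:R * (g t)^-1 ^+ m * g t.
  by case: (m) => [|m']; rewrite ?mul0r// exprSr -!mulrA mulVf ?mulr1.
have -> : (bump_deriv p m).[t] = p^`().[t] * g t ^+ 2 +
    2 * (t * p.[t] * (m%:R * g t - 1)).
  by rewrite /bump_deriv !hornerE /g; ring.
rewrite /= !fctE /GRing.scale/= -/(g t) mw -[m.+2]addn2 (exprD _ m 2).
have {}u0 : g t != 0 := u0.
move: (g t) u0 => u u0; move: (_ ^+ m) => W.
by field.
Unshelve. all: by end_near. Qed.

(** [phi] stands for a function of one variable together with its successive
    derivatives, and [s] for a multi-index. *)
Definition tensor (R : realType) n (phi : nat -> R -> R) (s : 'I_n -> nat)
    (x : 'rV[R]_n) : R :=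
  \prod_i phi (s i) (x ord0 i).

Lemma tensor_continuous (R : realType) n (phi : nat -> R -> R)
    (s : 'I_n -> nat) :
  (forall i t, is_derive t (1 : R) (phi i) (phi i.+1 t)) ->
  continuous (tensor phi s).
Proof.
move=> dphi; apply: continuous_big => [|i _ x].
  by move=> [a b]; exact: mul_continuous.
have cphi : {for x ord0 i, continuous (phi (s i))}.
  apply: differentiable_continuous; apply/derivable1_diffP.
  exact: (ex_derive (is_derive := dphi _ _)).
apply: (@cvg_comp _ _ _ (fun x : 'rV[R]_n => x ord0 i) (phi (s i))
  (nbhs x) (nbhs (x ord0 i))) cphi.
exact: coord_continuous.
Qed.

(** On a line parallel to the i-th axis all factors but one are constant. *)
Lemma is_derive_tensor (R : realType) n (phi : nat -> R -> R)
    (s : 'I_n -> nat) (x : 'rV[R]_n) i :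
  (forall i t, is_derive t (1 : R) (phi i) (phi i.+1 t)) ->
  is_derive x 'e_i (tensor phi s) (tensor phi (fun j => s j + (i == j))%N x).
Proof.
move=> dphi.
pose c := \prod_(j | j != i) phi (s j) (x ord0 j).
have tE h : tensor phi s (h *: 'e_i + x) = phi (s i) (h + x ord0 i) * c.
  rewrite /tensor (bigD1 i)//= !mxE !eqxx mulr1; congr (_ * _).
  by apply: eq_bigr => j ji; rewrite !mxE (negbTE ji) andbF mulr0 add0r.
have t0 : tensor phi s x = phi (s i) (x ord0 i) * c.
  by have := tE 0; rewrite scale0r !add0r.
have -> : tensor phi (fun j => s j + (i == j))%N x =
    c * phi (s i).+1 (x ord0 i).
  rewrite /tensor (bigD1 i)//= eqxx addn1 mulrC; congr (_ * _).
  by apply: eq_bigr => j ji; rewrite eq_sym (negbTE ji) addn0.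
have [dp Dp] := dphi (s i) (x ord0 i).
have cv : (fun h => h^-1 *:
    ((tensor phi s \o shift x) (h *: 'e_i) - tensor phi s x))
    @ 0^' --> c * phi (s i).+1 (x ord0 i).
  rewrite (_ : (fun h => _) = (fun h => c * (h^-1 *:
      ((phi (s i) \o shift (x ord0 i)) (h *: 1) - phi (s i) (x ord0 i))))).
    by apply: cvgM; [exact: cvg_cst|rewrite -Dp; exact: dp].
  apply/funext => h /=; rewrite tE t0 /GRing.scale/= mulr1 -mulrBl.
  by rewrite mulrA mulrC.
split; first by apply/cvg_ex; eexists; exact: cv.
exact/cvg_lim.
Qed.

Lemma smooth_tensor (R : realType) n (phi : nat -> R -> R) :
  (forall i t, is_derive t (1 : R) (phi i) (phi i.+1 t)) ->
  smooth (tensor phi (fun _ : 'I_n => 0%N)).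
Proof.
move=> dphi s.
rewrite (_ : iter_partial s _ = tensor phi (fun i => count_mem i s)).
  split=> [|x i]; first exact: tensor_continuous.
  exact: (ex_derive (is_derive := is_derive_tensor _ _ _ dphi)).
elim: s => [|i s IHs] //=.
rewrite IHs; apply/funext => x.
rewrite (derive_val (is_derive := is_derive_tensor _ _ _ dphi)).
by congr (tensor _ _ x); apply/funext => j; rewrite addnC.
Qed.

Definition bump_index (R : realType) (i : nat) : {poly R} * nat :=
  iter i (fun d => (bump_deriv d.1 d.2, d.2.+2)) (1, 0%N).

(** The i-th derivative of exp(-1 / (1 - t^2)). *)
Definition bump_family (R : realType) (i : nat) : R -> R :=
  bump (@bump_index R i).1 (@bump_index R i).2.

Definition cube_bump (R : realType) n : 'rV[R]_n -> R :=
  tensor (@bump_family R) (fun=> 0%N).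

Lemma bump_family0 (R : realType) (t : R) : `|t| < 1 ->
  bump_family 0 t = expR (- (1 - t ^+ 2)^-1).
Proof. by move=> t1; rewrite /bump_family /bump t1 /= hornerC !mul1r. Qed.

Lemma cube_bump_out (R : realType) n (x : 'rV[R]_n) i :
  1 <= `|x ord0 i| -> cube_bump x = 0.
Proof.
move=> xi; rewrite /cube_bump /tensor (bigD1 i)//=.
by rewrite /bump_family bump_out ?mul0r.
Qed.

(** For |t| <= 1/2 one has 1 / (1 - t^2) <= 4/3 < 2. *)
Lemma cube_bump_ge (R : realType) n (x : 'rV[R]_n) :
  (forall i, `|x ord0 i| <= 2^-1) -> expR (- 2) ^+ n <= cube_bump x.
Proof.
move=> xh; rewrite /cube_bump /tensor -[X in _ ^+ X]card_ord -prodr_const.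
apply: ler_prod => i _; rewrite expR_ge0/=.
have xi := xh i; have xi0 := normr_ge0 (x ord0 i).
rewrite bump_family0; last by lra.
rewrite ler_expR lerN2 -real_normK ?num_real//.
rewrite -[leRHS]invrK lef_pV2 ?posrE; nra.
Qed.

Lemma Cc_infty_cube_bump (R : realType) n : Cc_infty (@cube_bump R n).
Proof.
split.
  apply: smooth_tensor => i t; exact: is_derive_bump.
have cK : compact [set x : 'rV[R]_n | forall i, x ord0 i \in `[-1, 1]].
  apply: (@rV_compact R n (fun=> `[-1, 1]%classic)) => i.
  exact: segment_compact.
apply: (subclosed_compact _ cK); first exact: closed_closure.
rewrite closureE => x; apply; split.
  by apply: compact_closed => //; exact: norm_hausdorff.
move=> {}x /= x0 i /=; rewrite in_itv/= -ler_norml leNgt; apply/negP => xi.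
by move/eqP: x0; apply; apply: (@cube_bump_out _ _ _ i); exact: ltW.
Qed.

(** * Lower bounds for integrals *)

(** The integral of a nonnegative function is a supremum over the simple
    functions below it, hence is monotone even for functions that are not
    measurable.  This spares any proof that the level sets and the inner
    integral are measurable. *)
Lemma ge0_le_integralT d (T : measurableType d) (R : realType)
    (mu : {measure set T -> \bar R}) (f g : T -> \bar R) :
  (forall x, (0 <= f x)%E) -> (forall x, (f x <= g x)%E) ->
  (\int[mu]_(x in setT) f x <= \int[mu]_(x in setT) g x)%E.
Proof.
move=> f0 fg; have g0 x : (0 <= g x)%E := le_trans (f0 x) (fg x).
rewrite !ge0_integralTE//; apply: ereal_sup_le => _ [h /= hf <-].
by exists h => //= x; exact: le_trans (fg x).
Qed.

Lemma ge0_integral_le_indic d (T : measurableType d) (R : realType)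
    (mu : {measure set T -> \bar R}) (f : T -> \bar R) (A : set T) (c : R) :
  measurable A -> 0 <= c -> (forall x, (0 <= f x)%E) ->
  (forall x, A x -> (c%:E <= f x)%E) ->
  (c%:E * mu A <= \int[mu]_(x in setT) f x)%E.
Proof.
move=> mA c0 f0 cf.
rewrite -[A in mu A]setIT -integral_indic// -ge0_integralZl_EFin//; last first.
  by apply/measurable_EFinP; exact: measurable_indic.
apply: ge0_le_integralT => x; first by rewrite -EFinM lee_fin mulr_ge0.
rewrite indicE; have [/set_mem Ax|_] := boolP (x \in A).
  by rewrite mule1 cf.
by rewrite mule0.
Qed.

Definition rV_cube (R : realType) n (a : 'I_n -> R) (s : R) : set 'rV[R]_n :=
  [set x | forall i, a i <= x ord0 i < a i + s].

Lemma rV_cubeE (R : realType) n (a : 'I_n -> R) s :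
  rV_cube a s = [set x | forall i, `[a i, a i + s[%classic (x ord0 i)].
Proof.
by apply/seteqP; split => x /= + i => /(_ i); rewrite in_itv.
Qed.

Lemma measurable_cube (R : realType) n (a : 'I_n -> R) s :
  measurable (rV_cube a s).
Proof.
rewrite rV_cubeE.
by apply: (@measurable_rV_box _ _ (fun i => `[a i, a i + s[%classic)) => i.
Qed.

Lemma lebesgue_cube (R : realType) n (a : 'I_n -> R) s : 0 <= s ->
  lebesgue_rV R n (rV_cube a s) = (s ^+ n)%:E.
Proof.
move=> s0; rewrite rV_cubeE.
rewrite (@lebesgue_rV_box _ _ (fun i => `[a i, a i + s[%classic))//.
under eq_bigr => i _.
  rewrite lebesgue_measure_itv/= lte_fin ltrDl.
  rewrite (_ : (if _ then _ else _) = s%:E); last first.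
    case: ltP => [_|s0']; first by rewrite -EFinD addrAC subrr add0r.
    by congr EFin; apply/eqP; rewrite eq_le s0.
  over.
by rewrite prodEFin big_const_ord -Monoid.iteropE.
Qed.

Definition dyadic_cube (R : realType) n (r : R) (m : nat) : set 'rV[R]_n :=
  rV_cube (fun=> r * 2 ^+ m) (r * 2 ^+ m).

Lemma dyadic_cube_disjoint (R : realType) n (r : R) (x : 'rV[R]_n.+1) m m' :
  0 < r -> dyadic_cube r m x -> dyadic_cube r m' x -> m = m'.
Proof.
move=> r0 /(_ ord0) xm /(_ ord0) xm'.
have H a b : r * 2 ^+ a <= x ord0 ord0 < r * 2 ^+ a + r * 2 ^+ a ->
    r * 2 ^+ b <= x ord0 ord0 < r * 2 ^+ b + r * 2 ^+ b -> (a <= b)%N.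
  move=> /andP[xa _] /andP[_ xb].
  have := le_lt_trans xa xb; rewrite -mulrDr ltr_pM2l//.
  have -> : 2 ^+ b + 2 ^+ b = 2 ^+ b.+1 :> R by rewrite exprS mulrDl mul1r.
  by rewrite ltr_eXn2l ?ltnS// ltr1n.
by apply/eqP; rewrite eqn_leq !H.
Qed.

(** The dyadic cube of side rho has measure rho^n, so that [F] has integral at
    least c over each of them, and they are disjoint. *)
Lemma integral_dyadic_pinfty (R : realType) n (F : 'rV[R]_n.+1 -> \bar R)
    (c r : R) : 0 < c -> 0 < r -> (forall x, (0 <= F x)%E) ->
  (forall m x, dyadic_cube r m x ->
    ((c / (r * 2 ^+ m) ^+ n.+1)%:E <= F x)%E) ->
  (\int[lebesgue_rV R n.+1]_(x in setT) F x = +oo)%E.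
Proof.
move=> c0 r0 F0 cF.
pose w m := c / (r * 2 ^+ m) ^+ n.+1.
have rm0 m : 0 < r * 2 ^+ m :> R by rewrite mulr_gt0// exprn_gt0.
have w0 m : 0 <= w m by rewrite divr_ge0// ltW// exprn_gt0.
pose g m (x : 'rV[R]_n.+1) := ((w m)%:E * (\1_(dyadic_cube r m) x)%:E)%E.
have g0 m x : (0 <= g m x)%E by rewrite /g -EFinM lee_fin mulr_ge0.
have gout m x : ~ dyadic_cube r m x -> g m x = 0%E.
  by move=> xm; rewrite /g indicE memNset// mule0.
have mg m : measurable_fun setT (fun x => (\1_(dyadic_cube r m) x)%:E).
  by apply/measurable_EFinP; apply: measurable_indic; exact: measurable_cube.
have key N : ((N%:R * c)%:E <= \int[lebesgue_rV R n.+1]_(x in setT) F x)%E.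
  have <- : (\int[lebesgue_rV R n.+1]_(x in setT)
      (\sum_(m <- index_enum 'I_N) g m x) = (N%:R * c)%:E)%E.
    rewrite ge0_integral_sum//; last first.
      by move=> m; apply: measurable_funeM; exact: mg.
    rewrite (eq_bigr (fun=> c%:E)); last first.
      move=> m _; rewrite ge0_integralZl_EFin//; last exact: mg.
      rewrite integral_indic ?setIT//; last exact: measurable_cube.
      rewrite lebesgue_cube ?(ltW (rm0 _))// -EFinM /w divfK//.
      by rewrite expf_neq0// gt_eqF.
    by rewrite sumEFin sumr_const card_ord mulr_natl.
  apply: ge0_le_integralT => x; first by apply: sume_ge0.
  have [[m xm]|xN] := pselect (exists m : 'I_N, dyadic_cube r m x).
    rewrite (bigD1 m)//= big1 ?adde0.
      by rewrite /g indicE mem_set// mule1; exact: cF.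
    move=> m' m'm; apply: gout => xm'; move/eqP: m'm; apply.
    by apply: val_inj; exact: dyadic_cube_disjoint xm' xm.
  rewrite big1// => m _; apply: gout => xm; apply: xN; by exists m.
apply: eq_infty => A; apply: le_trans (key (Num.truncn (A / c)).+1).
by rewrite lee_fin -ler_pdivrMr// ltW// truncnS_gt.
Qed.

(** * Finite differences of the bump function *)

Lemma enorm_le (R : realType) n (x : 'rV[R]_n) M :
  (forall i, `|x ord0 i| <= M) -> enorm x <= n%:R * M.
Proof.
case: n x => [|n] x xM; first by rewrite /enorm big_ord0 sqrtr0 mul0r.
have M0 : 0 <= M := le_trans (normr_ge0 _) (xM ord0).
rewrite /enorm -[leRHS]ger0_norm ?mulr_ge0// -sqrtr_sqr ler_wsqrtr//.
rewrite (@le_trans _ _ (\sum_(i < n.+1) M ^+ 2))//.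
  by apply: ler_sum => i _; rewrite -real_normK ?num_real// ler_sqr ?nnegrE.
rewrite sumr_const card_ord exprMn -[leLHS]mulr_natl ler_wpM2r ?sqr_ge0//.
by rewrite expr2 ler_peMl// ler1n.
Qed.

Lemma enorm_gt0 (R : realType) n (x : 'rV[R]_n) i :
  x ord0 i != 0 -> 0 < enorm x.
Proof.
move=> xi; rewrite sqrtr_gt0 (bigD1 i)//= ltr_pwDl//.
  by rewrite exprn_even_gt0.
by apply: sumr_ge0 => j _; exact: sqr_ge0.
Qed.

Lemma ler_powR_nonpos (R : realType) (a b s : R) :
  0 < a -> a <= b -> s <= 0 -> b `^ s <= a `^ s.
Proof.
move=> a0 ab s0; have b0 := lt_le_trans a0 ab.
rewrite -[s]opprK !(powRN _ (- s)) lef_pV2 ?posrE ?powR_gt0//.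
by apply: ge0_ler_powR; rewrite ?oppr_ge0 ?nnegrE// ltW.
Qed.

Lemma fdiff_last (R : realType) n (f : 'rV[R]_n -> R) k h x :
  (forall j, (j < k)%N -> f (x + j%:R *: h) = 0) ->
  fdiff k h f x = f (x + k%:R *: h).
Proof.
move=> f0; rewrite /fdiff big_ord_recr/= big1 ?add0r.
  by rewrite subnn binn expr0 !mul1r.
by move=> j _; rewrite f0 ?mulr0.
Qed.

(** The exponent is the value of gamma / q. *)
Lemma EsetP (R : realType) n (f : 'rV[R]_n -> R) (lambda : R) k l x h :
  Eset lambda (- l%:R) k l f (x, h) <-> h != 0 /\ lambda < `|fdiff k h f x|.
Proof. by rewrite /Eset/= addNr powRr0 mulr1. Qed.

Definition inner_integral (R : realType) n k l (lambda s : R)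
    (f : 'rV[R]_n -> R) (x : 'rV[R]_n) : \bar R :=
  (\int[lebesgue_rV R n]_(h in setT)
    (\1_(Eset lambda (- l%:R) k l f) (x, h) * enorm h `^ s)%:E)%E.

(** Half of the lower bound of the bump function on the cube [-1/2, 1/2]^n, in
    order that the inequality be strict. *)
Definition bump_level (R : realType) (n : nat) : R := expR (- 2) ^+ n / 2.

Lemma bump_level_gt0 (R : realType) n : 0 < bump_level R n.
Proof. by rewrite divr_gt0// exprn_gt0// expR_gt0. Qed.

Lemma bump_level_lt (R : realType) n (x : 'rV[R]_n) :
  (forall i, `|x ord0 i| <= 2^-1) -> bump_level R n < `|cube_bump x|.
Proof.
move=> /cube_bump_ge xc; rewrite (lt_le_trans _ (ler_norm _))//.
rewrite (lt_le_trans _ xc)// /bump_level.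
have : 0 < expR (- 2) ^+ n :> R by rewrite exprn_gt0// expR_gt0.
by lra.
Qed.

Lemma inner_integrand_ge0 (R : realType) n k l (lambda s : R)
    (f : 'rV[R]_n -> R) x h :
  (0 <= (\1_(Eset lambda (- l%:R) k l f) (x, h) * enorm h `^ s)%:E)%E.
Proof. by rewrite lee_fin mulr_ge0// powR_ge0. Qed.

(** The points h with x + k h in the cube [-1/2, 1/2)^n form a cube of side 1/k,
    on which every coordinate of h is at most 3 rho.  For j < k the first
    coordinate of x + j h is at least 1, because it is the combination of that
    of x and of x + k h with weights 1 - j/k >= 1/k and j/k, and rho >= 2 k. *)
Lemma inner_integral_far (R : realType) n k l (s rho : R) (x : 'rV[R]_n.+1) :
  (0 < k)%N -> s <= 0 -> 2 * k%:R <= rho ->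
  (forall i, rho <= x ord0 i < rho + rho) ->
  ((k%:R^-1 ^+ n.+1 * (3 * n.+1%:R * rho) `^ s)%:E
     <= inner_integral k l (bump_level R n.+1) s (@cube_bump R n.+1) x)%E.
Proof.
move=> k0 s0 krho xrho.
have kR0 : 1 <= k%:R :> R by rewrite ler1n.
have kV0 : 0 < k%:R :> R by lra.
pose a i := (- 2^-1 - x ord0 i) / k%:R.
rewrite mulrC EFinM -(@lebesgue_cube R n.+1 a k%:R^-1) ?invr_ge0 ?ler0n//.
apply: ge0_integral_le_indic; [exact: measurable_cube|exact: powR_ge0| |].
  by move=> h; exact: inner_integrand_ge0.
move=> h hbox.
have hk i : - 2^-1 <= x ord0 i + k%:R * h ord0 i < 2^-1.
  have := hbox i; rewrite -[X in _ < _ + X]mul1r -mulrDl.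
  rewrite ler_pdivrMr// ltr_pdivlMr//.
  by lra.
have h0 : h ord0 ord0 < 0 by have := hk ord0; have := xrho ord0; nra.
have hn0 : 0 < enorm h by apply: (@enorm_gt0 _ _ _ ord0); rewrite lt_eqF.
rewrite indicE mem_set ?mul1r; last first.
  apply/EsetP; split.
    by apply: contraTneq h0 => ->; rewrite mxE ltxx.
  rewrite fdiff_last.
    apply: bump_level_lt => i; rewrite !mxE.
    by have := hk i; rewrite ler_norml; lra.
  (* k times the first coordinate of x + j h is at least (k - j) u - j / 2 *)
  move=> j jk; apply: (@cube_bump_out _ _ _ ord0).
  rewrite !mxE (le_trans _ (ler_norm _))//.
  have jk1 : j%:R + 1 <= k%:R :> R by rewrite natr1 ler_nat.
  have j0 : 0 <= j%:R :> R by [].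
  have := hk ord0; have := xrho ord0.
  move: (x ord0 ord0) (h ord0 ord0) h0 => u v v0 /andP[ru _] /andP[kv _].
  rewrite -(ler_pM2l kV0).
  have h1 : 0 <= j%:R * (2^-1 + u + k%:R * v) by rewrite mulr_ge0//; lra.
  have h2 : 0 <= (k%:R - 1 - j%:R) * u by rewrite mulr_ge0//; lra.
  nra.
rewrite lee_fin ler_powR_nonpos//.
rewrite [3 * _]mulrC -mulrA enorm_le// => i.
have := hk i; have := xrho i.
rewrite ler_norml; move: (x ord0 i) (h ord0 i) => u v ? ?.
apply/andP; split; nra.
Qed.

(** * Divergence of the double integral *)

Lemma inner_integral_ge0 (R : realType) n k l (lambda s : R)
    (f : 'rV[R]_n -> R) x :
  (0 <= inner_integral k l lambda s f x)%E.
Proof. by apply: integral_ge0 => h _; exact: inner_integrand_ge0. Qed.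

(** The level set is the complement of 0, and |h|^(-n) is at least a constant
    times rho^(-n) on the dyadic cube of side rho. *)
Lemma inner_integral_order0 (R : realType) n (x : 'rV[R]_n.+1) :
  (forall i, `|x ord0 i| <= 2^-1) ->
  inner_integral 0 0 (bump_level R n.+1) (- n.+1%:R)
    (@cube_bump R n.+1) x = +oo%E.
Proof.
move=> xh.
have c0 : 0 < ((2 * n.+1%:R) ^+ n.+1)^-1 :> R by rewrite invr_gt0 exprn_gt0.
apply: (integral_dyadic_pinfty c0 (@ltr01 R)) => [h|m h].
  exact: inner_integrand_ge0.
rewrite mul1r /dyadic_cube /rV_cube /= mul1r => hm.
have m0 : 0 < 2 ^+ m :> R by rewrite exprn_gt0.
have h0 : 0 < h ord0 ord0 by have /andP[/(lt_le_trans m0)] := hm ord0.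
rewrite indicE mem_set ?mul1r; last first.
  apply/EsetP; split; first by apply: contraTneq h0 => ->; rewrite mxE ltxx.
  by rewrite fdiff_last// scale0r addr0; exact: bump_level_lt.
rewrite lee_fin -invfM -exprMn -powR_invn; last first.
  by rewrite !mulr_ge0// ltW.
apply: ler_powR_nonpos; first by apply: (@enorm_gt0 _ _ _ ord0); rewrite gt_eqF.
  rewrite [2 * _]mulrC -mulrA enorm_le// => i.
  by have /andP[h1 h2] := hm i; rewrite ger0_norm; lra.
by rewrite oppr_le0.
Qed.

(** The inner integral is infinite on a whole cube, of measure 1. *)
Lemma integral_inner_order0 (R : realType) n (a : R) : 0 < a ->
  (\int[lebesgue_rV R n.+1]_(x in setT)
    inner_integral 0 0 (bump_level R n.+1) (- n.+1%:R)
      (@cube_bump R n.+1) x `^ a = +oo)%E.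
Proof.
move=> a0; apply: eq_infty => A.
have H : (A%:E <=
    `|A|%:E * lebesgue_rV R n.+1 (rV_cube (fun=> - 2^-1)%R 1%R))%E.
  by rewrite lebesgue_cube// expr1n mule1 lee_fin ler_norm.
apply: (le_trans H); apply: ge0_integral_le_indic => //.
- exact: measurable_cube.
- by move=> x; exact: poweR_ge0.
- move=> x xb; rewrite inner_integral_order0 ?poweRyr ?gt_eqF ?leey// => i.
  by have := xb i; rewrite ler_norml; lra.
Qed.

(** At size rho the integrand is at least a constant times rho^(s a), which is
    at least rho^(-n). *)
Lemma integral_inner_far (R : realType) n k l (s a : R) :
  (0 < k)%N -> s <= 0 -> 0 <= a -> - n.+1%:R <= s * a ->
  (\int[lebesgue_rV R n.+1]_(x in setT)
    inner_integral k l (bump_level R n.+1) s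
      (@cube_bump R n.+1) x `^ a = +oo)%E.
Proof.
move=> k0 s0 a0 sa.
have kR : 0 < k%:R :> R by rewrite ltr0n.
have n0 : 0 < 3 * n.+1%:R :> R by rewrite mulr_gt0.
have kn0 : 0 < k%:R^-1 ^+ n.+1 :> R by rewrite exprn_gt0// invr_gt0.
have c0 : 0 < (k%:R^-1 ^+ n.+1 * (3 * n.+1%:R) `^ s) `^ a.
  by rewrite powR_gt0// mulr_gt0// powR_gt0.
have r0 : 0 < 2 * k%:R :> R by rewrite mulr_gt0.
apply: (integral_dyadic_pinfty c0 r0) => [x|m x]; first exact: poweR_ge0.
rewrite /dyadic_cube; set rho := 2 * k%:R * 2 ^+ m => xrho.
have krho : 2 * k%:R <= rho by rewrite ler_peMr ?(ltW r0)// exprn_ege1// ler1n.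
have rho1 : 1 <= rho.
  by rewrite (le_trans _ krho)// -natrM ler1n muln_gt0.
have rho0 : 0 < rho := lt_le_trans ltr01 rho1.
apply: (@le_trans _ _ ((k%:R^-1 ^+ n.+1 * (3 * n.+1%:R * rho) `^ s)%:E `^ a)%E).
  rewrite poweR_EFin lee_fin.
  rewrite [(_ * rho) `^ s]powRM ?(ltW n0) ?(ltW rho0)// mulrA.
  rewrite [leRHS]powRM ?powR_ge0 ?mulr_ge0 ?powR_ge0 ?(ltW kn0)//.
  by rewrite ler_wpM2l ?powR_ge0// -powRrM -powR_invn ?(ltW rho0)// ler_powR.
apply: gt0_ler_poweR => //;
  rewrite ?in_itv/= ?leey ?andbT ?inner_integral_ge0//.
  by rewrite lee_fin mulr_ge0 ?powR_ge0 ?(ltW kn0).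
exact: inner_integral_far.
Qed.

Unset Implicit Arguments.
Set Strict Implicit.

Theorem proposition3p12 (R : realType) (n k l : nat) (p q gamma : R)
  (n_gt0 : (0 < n)%N) (lek : (l <= k)%N) (p_ge1 : 1 <= p) (q_gt0 : 0 < q)
  (hpq : l%:R <= n%:R * (p^-1 - q^-1))
  (hgamma : gamma = - (l%:R * q)) :
  exists f : 'rV[R]_n -> R, Cc_infty f /\
    ereal_sup [set ((lambda `^ p)%:E *
        \int[lebesgue_rV R n]_(x in setT)
          (\int[lebesgue_rV R n]_(h in setT)
             (\1_(Eset lambda (gamma / q) k l f) (x, h)
                * enorm h `^ (gamma - n%:R))%:E) `^ (p / q))%E
      | lambda in [set lambda : R | 0 < lambda]] = +oo%E.
Proof.
case: n n_gt0 hpq => [//|n] _ hpq.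
have p0 : 0 < p by lra.
have gq : gamma / q = - l%:R by rewrite hgamma mulNr mulfK ?gt_eqF.
exists (@cube_bump R n.+1); split; first exact: Cc_infty_cube_bump.
apply: ereal_supy; exists (bump_level R n.+1); first exact: bump_level_gt0.
rewrite gq.
have l0 := bump_level_gt0 R n.+1.
suff -> : (\int[lebesgue_rV R n.+1]_(x in setT)
    inner_integral k l (bump_level R n.+1) (gamma - n.+1%:R)
      (@cube_bump R n.+1) x `^ (p / q) = +oo)%E.
  by rewrite gt0_muley// lte_fin powR_gt0.
have [k0|k0] := posnP k.
  move: lek hgamma; rewrite k0 leqn0 => /eqP -> ->; rewrite mul0r oppr0 sub0r.
  by apply: integral_inner_order0; rewrite divr_gt0.
apply: integral_inner_far => //.
- by rewrite hgamma -opprD oppr_le0 addr_ge0// mulr_ge0// ltW.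
- by rewrite divr_ge0 ?ltW.
- have := ler_wpM2r (ltW p0) hpq.
  have -> : n.+1%:R * (p^-1 - q^-1) * p = n.+1%:R - n.+1%:R * (p / q).
    by field; rewrite !gt_eqF.
  have -> : (gamma - n.+1%:R) * (p / q) = - (l%:R * p) - n.+1%:R * (p / q).
    by rewrite hgamma; field; rewrite gt_eqF.
  by lra.
Qed.
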